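(* Let $\mathbb{K}$ be a field, $G$ a simple graph on $[n]$ and $H$ an induced subgraph of $G$. Let $S=\mathbb{K}[x_k,y_k : k\in[n]]$, $S_H=\mathbb{K}[x_k,y_k : k\in V(H)]$, and let $\mathcal{I}_G=(x_ix_j-y_iy_j : \{i,j\}\in E(G))\subset S$, $\mathcal{I}_H=(x_ix_j-y_iy_j : \{i,j\}\in E(H))\subset S_H$. Then $\beta_{i,j}^{S_H}(S_H/\mathcal{I}_H)\leq \beta_{i,j}^S(S/\mathcal{I}_G)$ for all $i,j$.
   Context: All polynomial rings are standard graded; $\beta^R_{i,j}(M)$ denotes the $(i,j)$-th graded Betti number of $M$ over $R$. *)

(* Defs.v *)
From HB Require Import structures.
From mathcomp Require Import all_boot all_order all_algebra.
From mathcomp Require Import mpoly.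
From Stdlib Require Import ClassicalEpsilon.

Set Implicit Arguments.
Unset Strict Implicit.
Unset Printing Implicit Defensive.

Import GRing.Theory.
Local Open Scope ring_scope.

Definition simple_graph (n : nat) (E : rel 'I_n) : Prop :=
  ssrbool.symmetric E /\ ssrbool.irreflexive E.

Definition induced_subgraph (m n : nat) (EH : rel 'I_m) (EG : rel 'I_n)
  (f : 'I_m -> 'I_n) : Prop :=
  injective f /\ forall i j, EH i j = EG (f i) (f j).

Definition xvar (K : fieldType) (n : nat) (k : 'I_n) : {mpoly K[n + n]} :=
  'X_(lshift n k).
Definition yvar (K : fieldType) (n : nat) (k : 'I_n) : {mpoly K[n + n]} :=
  'X_(rshift n k).

Definition in_ideal (R : comNzRingType) (I : finType) (g : I -> R) (p : R) :
  Prop := exists c : I -> R, p = \sum_(i : I) c i * g i.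

(* Generators x_i x_j - y_i y_j, indexed by (ordered) pairs that are edges; *)
(* each edge {i,j} appears twice (as (i,j),(j,i)) with the same generator. *)
Definition binom_edge_gen (K : fieldType) (n : nat) (E : rel 'I_n)
  (e : 'I_n * 'I_n) : {mpoly K[n + n]} :=
  if E e.1 e.2 then xvar K e.1 * xvar K e.2 - yvar K e.1 * yvar K e.2 else 0.

Definition I_G (K : fieldType) (n : nat) (E : rel 'I_n) :
  {mpoly K[n + n]} -> Prop :=
  fun p => in_ideal (binom_edge_gen K E) p.

(* Graded free resolutions of S/I, S = {mpoly K[N]} standard graded.       *)
(*   F_i = S^(b i) (row vectors), generator k of F_i has degree a i k;    *)
(*   the differential F_(i+1) -> F_i is  v |-> v *m D i.                   *)
(*   F_0 = S (b 0 = 1, a 0 _ = 0) and coker(D 0) = S/I.                    *)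
Record gfres (K : fieldType) (N : nat) := GFRes {
  rk : nat -> nat;
  deg : forall i, 'I_(rk i) -> nat;
  dif : forall i, 'M[{mpoly K[N]}]_(rk i.+1, rk i)
}.

Definition homog_of (K : fieldType) (N : nat) (d : nat) (p : {mpoly K[N]}) :
  Prop := forall m : 'X_{1..N}, p@_m != 0 -> mdeg m = d.

Definition is_gfres (K : fieldType) (N : nat) (I : {mpoly K[N]} -> Prop)
  (F : gfres K N) : Prop :=
  [/\ rk F 0 = 1%N,
      (forall k, @deg _ _ F 0 k = 0%N),
      (forall i k l, dif F i k l = 0 \/
         exists2 d, (@deg _ _ F i l + d = @deg _ _ F i.+1 k)%N & homog_of d (dif F i k l)),
      (* exactness at F_(i+1), i >= 0 (which includes d^2 = 0)              *)
      (forall i (v : 'rV_(rk F i.+1)),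
         v *m dif F i = 0 <-> exists w, v = w *m dif F i.+1) &
      (forall v : 'rV_(rk F 0),
         (forall k, I (v 0 k)) <-> exists w, v = w *m dif F 0)].

(* minimal: all entries of all differentials lie in the homogeneous        *)
(* maximal ideal (x_1,...,y_n), i.e. have zero constant term.              *)
Definition is_min_gfres (K : fieldType) (N : nat) (I : {mpoly K[N]} -> Prop)
  (F : gfres K N) : Prop :=
  is_gfres I F /\ forall i k l, (dif F i k l)@_0%MM = 0.

(* graded Betti number beta_{i,j}(S/I): the number of generators of degree *)
(* j of F_i in a minimal graded free resolution F of S/I (well defined, as  *)
(* minimal graded free resolutions exist and are unique up to isomorphism). *)
Definition betti (K : fieldType) (N : nat) (I : {mpoly K[N]} -> Prop)
  (i j : nat) : nat :=
  match excluded_middle_informative (exists F, is_min_gfres I F) with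
  | left h =>
      let F := proj1_sig (constructive_indefinite_description _ h) in
      #|[set k : 'I_(rk F i) | @deg _ _ F i k == j]|
  | right _ => 0%N
  end.

(* Main.v *)
(* S_H/I_H is an algebra retract of S/I_G: the inclusion iota : S_H -> S has the
   left inverse pi : S -> S_H killing the variables of the vertices outside H,
   and both send one edge ideal into the other. Let F and G be minimal graded
   free resolutions of S_H/I_H and S/I_G. Lifting gives graded comparison maps
   phi : iota F -> G and psi : pi G -> F. The composite pi(phi) psi is a chain
   endomorphism of F lifting the identity, hence homotopic to it, and by
   minimality of F it is the identity modulo the maximal ideal. So the constant
   parts of phi and psi exhibit K^(beta_ij(H)) as a retract of K^(beta_ij(G)).
   Since betti is 0 when no minimal resolution exists, one must also be built for
   S/I_G: Dickson's lemma gives the Hilbert basis theorem, hence finitely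
   generated syzygies. *)
Require Import Defs.
From mathcomp Require Import all_boot all_order all_algebra.
From mathcomp Require Import mpoly.
From Stdlib Require Import Classical ClassicalEpsilon.

Set Implicit Arguments.
Unset Strict Implicit.
Unset Printing Implicit Defensive.

Import Order.TTheory GRing.Theory.
Local Open Scope ring_scope.

(** * Noetherianity of polynomial rings *)

(** Dickson's lemma, by induction on [n]. A list settling the first [n] coordinates also settles
    every element whose coordinate [n] is at least the maximum [N] over that list; the rest lie in
    finitely many slices. *)
Lemma dickson (T : eqType) (g : nat -> T -> nat) (n : nat) (P : T -> Prop) :
  exists l : seq T, (forall u, u \in l -> P u) /\
    forall t, P t ->
      exists2 u, u \in l & forall k, (k < n)%N -> (g k u <= g k t)%N.
Proof.
elim: n P => [|n IHn] P.
  case: (classic (exists t, P t)) => [[t Pt]|noP].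
    exists [:: t]; split=> [u|u _]; first by rewrite inE => /eqP->.
    by exists t; rewrite ?inE.
  by exists [::]; split=> // t Pt; case: noP; exists t.
have [l0 [Pl0 l0P]] := IHn P.
pose N := \max_(u <- l0) g n u.
have [l [Pl lP]] : exists l : seq T, (forall u, u \in l -> P u) /\
    forall t, P t -> (g n t < N)%N ->
      exists2 u, u \in l & forall k, (k < n.+1)%N -> (g k u <= g k t)%N.
  (* Each increment of [N] adds one slice on which coordinate [n] is constant, so [IHn] covers
     it. *)
  elim: N => [|N [l [Pl lP]]]; first by exists [::].
  have [l1 [Pl1 l1P]] := IHn (fun t => P t /\ g n t = N).
  exists (l ++ l1); split=> [u|t Pt].
    by rewrite mem_cat => /orP[/Pl|/Pl1[]].
  rewrite ltnS leq_eqVlt => /orP[/eqP gN|/(lP _ Pt)[u ul uP]].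
    have [|u ul uP] := l1P t; first by split.
    exists u => [|k]; first by rewrite mem_cat ul orbT.
    rewrite ltnS leq_eqVlt => /orP[/eqP->|/uP//].
    by rewrite gN; have [_ ->] := Pl1 _ ul.
  by exists u; rewrite ?mem_cat ?ul.
exists (l0 ++ l); split=> [u|t Pt]; first by rewrite mem_cat => /orP[/Pl0|/Pl].
case: (ltnP (g n t) N) => [/(lP _ Pt)[u ul uP]|leN].
  by exists u; rewrite ?mem_cat ?ul ?orbT.
have [u ul uP] := l0P t Pt; exists u => [|k]; first by rewrite mem_cat ul.
rewrite ltnS leq_eqVlt => /orP[/eqP->|/uP//].
by apply: leq_trans leN; apply: leq_bigmax_seq ul isT.
Qed.

(** Dickson yields finitely many members of [I] such that every leading monomial in [I] is divisible
    by one of theirs. Division by them strictly lowers the leading monomial, hence terminates. *)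
Lemma hilbert_basis (K : fieldType) (n : nat) (I : {mpoly K[n]} -> Prop) :
  (forall p q, I p -> I q -> I (p + q)) -> (forall c p, I p -> I (c * p)) ->
  exists s (g : 'cV[{mpoly K[n]}]_s), (forall i, I (g i 0)) /\
    forall p, I p -> exists c : 'rV_s, p%:M = c *m g.
Proof.
move=> ID IM.
have [l [Il lP]] := dickson
  (fun k (p : {mpoly K[n]}) => nth 0%N (multinom_val (mlead p)) k) n (fun p => I p /\ p != 0).
exists (size l), (\col_i l`_i); split=> [i|p].
  by rewrite mxE; have [] := Il _ (mem_nth 0 (ltn_ord i)).

have [->|p0] := eqVneq p 0.
  by exists 0; rewrite mul0mx raddf0.
have [m mE] := ex_intro (eq (mlead p)) _ erefl.
elim/(@ltmwf n): m p p0 mE => m IHm p p0 mE Ip.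
have [u ul leu] := lP p (conj Ip p0).
have [Iu u0] := Il u ul.
have leU : (mlead u <= mlead p)%MM.
  by apply/mnm_lepP => k; have := leu k (ltn_ord k); rewrite -!mnm_nth.
(* The term for which [a * u] and [p] have the same leading term, so that the difference loses
   it. *)
pose a := (p@_(mlead p) / u@_(mlead u)) *: 'X_[mlead p - mlead u].
have a0 : p@_(mlead p) / u@_(mlead u) != 0.
  by rewrite mulf_neq0 ?invr_eq0 ?mleadc_eq0.
have X0 : 'X_[mlead p - mlead u] != 0 :> {mpoly K[n]}.
  by rewrite -mleadc_eq0 mleadXm mcoeffX eqxx oner_neq0.
have lq : mlead (a * u) = mlead p.
  by rewrite -scalerAl mleadZ // mleadM // mleadXm submK.
have cq : (a * u)@_(mlead p) = p@_(mlead p).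
  rewrite -scalerAl mcoeffZ.
  have -> : ('X_[mlead p - mlead u] * u)@_(mlead p) = u@_(mlead u).
    by rewrite -[X in _@_X = _](submK leU) mulrC mcoeffMX.
  by rewrite divfK ?mleadc_eq0.
pose k := Ordinal (etrans (index_mem u l) ul).
have uE : u = l`_k by rewrite nth_index.
suff [c cE] : exists c : 'rV_(size l), (p - a * u)%:M = c *m \col_i l`_i.
  exists (c + a *: delta_mx 0 k); rewrite mulmxDl -cE -scalemxAl -rowE.
  apply/rowP => j; rewrite !mxE ord1 eqxx -uE !mulr1n subrK //.
have [->|q0] := eqVneq (p - a * u) 0.
  by exists 0; rewrite mul0mx raddf0.
apply: (IHm (mlead (p - a * u))) => //; last first.
  by apply: ID => //; rewrite -mulNr; apply: IM.
rewrite -mE lt_neqAle; apply/andP; split; last first.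
  by apply: le_trans (mleadB_le _ _) _; rewrite lq joinxx.
apply: contraNneq q0 => E; rewrite -mleadc_eq0 E mcoeffB cq subrr //.
Qed.

(** Induction on the rank: first coordinates form a finitely generated ideal, and vectors with first
    coordinate 0 form a submodule of smaller rank. *)
Lemma noetherian_rV (K : fieldType) (n r : nat)
    (M : 'rV[{mpoly K[n]}]_r -> Prop) :
  M 0 -> (forall u v, M u -> M v -> M (u + v)) ->
  (forall c u, M u -> M (c *: u)) ->
  exists s (G : 'M[{mpoly K[n]}]_(s, r)), forall v, M v <-> exists w, v = w *m G.
Proof.
elim: r M => [|r IHr]; last rewrite -[r.+1]add1n; move=> M M0 MD MZ.
  exists 0%N, 0 => v; rewrite (thinmx0 v).
  by split=> // _; exists 0; rewrite mulmx0.
pose I p := exists v : 'rV_(1 + r), M v /\ lsubmx v = p%:M.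
have [||s [g [Ig gP]]] := @hilbert_basis K n I.
- move=> p q [u [Mu up]] [v [Mv vq]]; exists (u + v); split; first exact: MD.
  by rewrite linearD /= up vq raddfD.
- move=> c p [u [Mu up]]; exists (c *: u); split; first exact: MZ.
  by rewrite linearZ /= up scale_scalar_mx.
have /fin_all_exists[x xP] := Ig.
pose V : 'M_(s, 1 + r) := \matrix_i x i.
have MVr i : M (row i V) by rewrite rowK; case: (xP i).
have Vg : lsubmx V = g.
  apply/matrixP => i j; rewrite ord1.
  by have /matrixP/(_ 0 0) := (xP i).2; rewrite !mxE eqxx mulr1n.
have MV k (A : 'M_(k, 1 + r)) w : (forall i, M (row i A)) -> M (w *m A).
  move=> MA; rewrite mulmx_sum_row; elim/big_ind: _ => // i _; exact: MZ.
have [||| s' [G GP]] := IHr (fun u => M (row_mx 0 u)).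
- by rewrite row_mx0.
- by move=> u v Mu Mv; rewrite -[0](addr0 0) -add_row_mx; apply: MD.
- by move=> c u Mu; rewrite -(scaler0 _ c) -scale_row_mx; apply: MZ.
exists (s + s')%N, (col_mx V (row_mx 0 G)) => v; split=> [Mv|[w ->]]; last first.
  apply: MV => i; case: (split_ordP i) => j ->; first by rewrite rowKu.
  by rewrite rowKd row_row_mx row0; apply/GP; exists (delta_mx 0 j); rewrite rowE.
(* A combination of the lifted generators [V] matches the first coordinate of [v]; the difference is
   handled by [G]. *)
have [c cE] : exists c : 'rV_s, lsubmx v = c *m g.
  have [c cE] := gP _ (ex_intro _ v (conj Mv (mx11_scalar (lsubmx v)))).
  by exists c; rewrite -cE -mx11_scalar.
have E : row_mx 0 (rsubmx (v - c *m V)) = v - c *m V.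
  rewrite -[RHS]hsubmxK; congr row_mx.
  by rewrite linearB /= cE -mulmx_lsub Vg subrr.
have /GP[w wE] : M (row_mx 0 (rsubmx (v - c *m V))).
  rewrite E; apply: MD => //; rewrite -scaleN1r; apply: MZ; exact: MV.
exists (row_mx c w); rewrite mul_row_col mul_mx_row mulmx0 -wE.
by rewrite E addrC subrK.
Qed.

(** * Graded matrices and minimal homogeneous generators *)

Section Homogeneous.

Variables (K : fieldType) (n : nat).
Implicit Types (p q : {mpoly K[n]}) (a b c e : nat).

(* An entry of a graded matrix, from a generator of degree a to one of degree b,
   has degree a - b; adding b on the other side avoids truncated subtraction. *)
Definition hpart a b p : {mpoly K[n]} :=
  \sum_(m <- msupp p | (mdeg m + b == a)%N) p@_m *: 'X_[m].

Definition hent a b p := forall m, p@_m != 0 -> (mdeg m + b)%N = a.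

Lemma mcoeff_hpart a b p m :
  (hpart a b p)@_m = if (mdeg m + b == a)%N then p@_m else 0.
Proof.
rewrite /hpart raddf_sum /=; have [mp|mNp] := boolP (m \in msupp p); last first.
  rewrite (memN_msupp_eq0 mNp) if_same big_seq_cond big1 // => k /andP[kp _].
  rewrite mcoeffZ mcoeffX; case: eqP => [E|_]; last by rewrite mulr0.
  by rewrite -E kp in mNp.
rewrite big_mkcond (bigD1_seq m) ?msupp_uniq //= big1 => [|k km]; last first.
  by case: ifP => // _; rewrite mcoeffZ mcoeffX (negPf km) mulr0.
by rewrite addr0; case: ifP => // _; rewrite mcoeffZ mcoeffX eqxx mulr1.
Qed.

Lemma hpart0 a b : hpart a b 0 = 0.
Proof. by apply/mpolyP => m; rewrite mcoeff_hpart mcoeff0 if_same. Qed.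

Lemma hpart_sum (I : finType) a b (F : I -> {mpoly K[n]}) :
  hpart a b (\sum_i F i) = \sum_i hpart a b (F i).
Proof.
apply/mpolyP => m; rewrite mcoeff_hpart !raddf_sum /=.
under [RHS]eq_bigr => i _ do rewrite mcoeff_hpart.
by case: ifP => // _; rewrite big1_eq.
Qed.

Lemma hent_hpart a b p : hent a b (hpart a b p).
Proof. by move=> m; rewrite mcoeff_hpart; case: (_ =P a) => [->|_ /eqP[]]. Qed.

Lemma hpart_id a b p : hent a b p -> hpart a b p = p.
Proof.
move=> hp; apply/mpolyP => m; rewrite mcoeff_hpart.
by have [->|/hp->] := eqVneq p@_m 0; rewrite ?if_same ?eqxx.
Qed.

(** Every monomial of [q] has degree [b - c], so selecting a degree in the product amounts to
    selecting the shifted degree in [p]. *)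
Lemma hpartMr a b c p q : hent b c q -> hpart a c (p * q) = hpart a b p * q.
Proof.
move=> hq; apply/mpolyP => m; rewrite mcoeff_hpart !mcoeffM.
case: ifP => E.
  apply: eq_bigr => k /eqP mE; rewrite mcoeff_hpart.
  have [->|/hq qE] := eqVneq q@_k.2 0; first by rewrite !mulr0.
  by rewrite -qE addnA -mdegD -mE E.
symmetry; apply: big1 => k /eqP mE; rewrite mcoeff_hpart.
have [->|/hq qE] := eqVneq q@_k.2 0; first by rewrite !mulr0.
by rewrite -qE addnA -mdegD -mE E mul0r.
Qed.

Lemma hpartMl a b c p q : hent a b p -> hpart a c (p * q) = p * hpart b c q.
Proof.
move=> hp; apply/mpolyP => m; rewrite mcoeff_hpart !mcoeffM.
have E k1 k2 : m = (k1 + k2)%MM -> p@_k1 != 0 ->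
    (mdeg k2 + c == b)%N = (mdeg m + c == a)%N.
  by move=> -> /hp <-; rewrite mdegD -addnA eqn_add2l.
case: ifP => mE; [|symmetry; apply: big1 => k /eqP kE].
  apply: eq_bigr => k /eqP kE; rewrite mcoeff_hpart.
  have [->|/(E _ _ kE)->] := eqVneq p@_k.1 0; first by rewrite !mul0r.
  by rewrite mE.
rewrite mcoeff_hpart.
have [->|/(E _ _ kE)->] := eqVneq p@_k.1 0; first by rewrite !mul0r.
by rewrite mE mulr0.
Qed.

Lemma sum_hpart b p A : (msize p + b <= A)%N ->
  \sum_(a < A) hpart a b p = p.
Proof.
move=> leA; apply/mpolyP => m; rewrite raddf_sum /=.
under eq_bigr => a _ do rewrite mcoeff_hpart.
have [E|/[dup] p0] := eqVneq p@_m 0; first by rewrite big1 // => a _; rewrite E if_same.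
rewrite -mcoeff_msupp => /msize_mdeg_lt lt.
have ltA : (mdeg m + b < A)%N by apply: leq_trans leA; rewrite ltn_add2r.
rewrite (bigD1 (Ordinal ltA)) //= eqxx big1 ?addr0 // => a aN.
case: eqP => // E; case/eqP: aN; exact/val_inj.
Qed.

(** The degree-preserving component of a map of graded free modules. For a row vector and constant
    [a] equal to [e], it is the component of degree [e]. *)
Definition mhpart r s (a : 'I_r -> nat) (b : 'I_s -> nat)
  (A : 'M[{mpoly K[n]}]_(r, s)) := \matrix_(i, j) hpart (a i) (b j) (A i j).

Definition mhent r s (a : 'I_r -> nat) (b : 'I_s -> nat)
  (A : 'M[{mpoly K[n]}]_(r, s)) := forall i j, hent (a i) (b j) (A i j).

Lemma mhent_mhpart r s (a : 'I_r -> nat) (b : 'I_s -> nat) A :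
  mhent a b (mhpart a b A).
Proof. by move=> i j; rewrite mxE; apply: hent_hpart. Qed.

Lemma mhpart_id r s (a : 'I_r -> nat) (b : 'I_s -> nat) A :
  mhent a b A -> mhpart a b A = A.
Proof. by move=> hA; apply/matrixP => i j; rewrite mxE hpart_id. Qed.

Lemma mhpartMr r s t (a : 'I_r -> nat) (b : 'I_s -> nat) (c : 'I_t -> nat) A B :
  mhent b c B -> mhpart a c (A *m B) = mhpart a b A *m B.
Proof.
move=> hB; apply/matrixP => i j; rewrite !mxE hpart_sum /=.
by apply: eq_bigr => k _; rewrite !mxE (hpartMr _ _ (hB k j)).
Qed.

Lemma mhpartMl r s t (a : 'I_r -> nat) (b : 'I_s -> nat) (c : 'I_t -> nat) A B :
  mhent a b A -> mhpart a c (A *m B) = A *m mhpart b c B.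
Proof.
move=> hA; apply/matrixP => i j; rewrite !mxE hpart_sum /=.
by apply: eq_bigr => k _; rewrite !mxE (hpartMl _ _ (hA i k)).
Qed.

Lemma mhpart0 r s (a : 'I_r -> nat) (b : 'I_s -> nat) : mhpart a b 0 = 0.
Proof. by apply/matrixP => i j; rewrite !mxE hpart0. Qed.

(** * Generators of graded submodules *)

Section GradedSubmodule.

Variables (r : nat) (d : 'I_r -> nat) (M : 'rV[{mpoly K[n]}]_r -> Prop).
Hypotheses (M0 : M 0) (MD : forall u v, M u -> M v -> M (u + v)).
Hypotheses (MZ : forall (c : {mpoly K[n]}) u, M u -> M (c *: u)).
Hypothesis (Mh : forall e v, M v -> M (mhpart (fun=> e) d v)).

Definition spans s (G : 'M[{mpoly K[n]}]_(s, r)) :=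
  forall v, M v <-> exists w, v = w *m G.

Lemma spans_row s (G : 'M_(s, r)) : spans G -> forall k, M (row k G).
Proof. by move=> GM k; apply/GM; exists (delta_mx 0 k); rewrite rowE. Qed.

Lemma mulmx_in s (G : 'M_(s, r)) : (forall k, M (row k G)) ->
  forall w, M (w *m G).
Proof.
by move=> GM w; rewrite mulmx_sum_row; elim/big_ind: _ => // i _; apply: MZ.
Qed.

Lemma homogeneous_generators : exists s (d' : 'I_s -> nat) (G : 'M_(s, r)),
  mhent d' d G /\ spans G.
Proof.
have [s0 [G0 G0P]] := noetherian_rV M0 MD MZ.
(* [msize] is one more than the degree of a nonzero polynomial, so all shifted degrees lie strictly
   below [A]. *)
pose A := \max_i \max_j (msize (G0 i j) + d j).
have AE i j : \sum_(a < A) hpart a (d j) (G0 i j) = G0 i j.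
  apply: sum_hpart; rewrite /A; apply: leq_trans (leq_bigmax i).
  exact: leq_trans (leq_bigmax j).
(* The new generators are the homogeneous components of the old ones, indexed by generator and
   degree. *)
pose I := ('I_s0 * 'I_A)%type.
pose x (k : 'I_#|{: I}|) : I := enum_val k.
pose G : 'M_(#|{: I}|, r) := \matrix_(k, j)
  hpart (x k).2 (d j) (G0 (x k).1 j).
exists #|{: I}|, (fun k => val (x k).2), G; split.
  by move=> k j; rewrite mxE; apply: hent_hpart.
move=> v; split=> [/G0P[w ->]|[w ->]]; last first.
  apply: mulmx_in => k.
  have -> : row k G = mhpart (fun=> val (x k).2) d (row (x k).1 G0).
    by apply/rowP => j; rewrite !mxE.
  by apply: Mh; apply: spans_row.
(* Each component inherits the coefficient of the generator it comes from. *)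
exists (\row_k w 0 (x k).1); apply/rowP => j; rewrite !mxE.
under [RHS]eq_bigr => k _ do rewrite !mxE.
rewrite -(big_enum_val (fun y : I => w 0 y.1 * hpart y.2 (d j) (G0 y.1 j))).
rewrite -(pair_bigA _ (fun i (a : 'I_A) => w 0 i * hpart a (d j) (G0 i j))) /=.
by apply: eq_bigr => i _; rewrite -mulr_sumr AE.
Qed.

(* A homogeneous syzygy with a nonzero constant entry makes the corresponding
   generator redundant, so a generating set of least size works. *)
Lemma minimal_homogeneous_generators :
  exists s (d' : 'I_s -> nat) (G : 'M_(s, r)),
  [/\ mhent d' d G, spans G &
      forall v : 'rV_s, v *m G = 0 -> forall k, (v 0 k)@_0%MM = 0].
Proof.
have [s [d' [G [hG GM]]]] := homogeneous_generators.
elim: s d' G hG GM => [|s IHs] d' G hG GM.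
  by exists 0%N, d', G; split=> // v _ [].
case: (classic (forall v : 'rV_s.+1, v *m G = 0 -> forall k, (v 0 k)@_0%MM = 0)).
  by move=> H; exists s.+1, d', G.
move=> /not_all_ex_not[v nv]; have [vG nk] := imply_to_and _ _ nv.
have [k /eqP vk0] := not_all_ex_not _ _ nk.
have hG' : mhent (fun i => d' (lift k i)) d (row' k G).
  by move=> i j; rewrite mxE; apply: hG.
suff GM' : spans (row' k G) by exact: IHs hG' GM'.
move=> u.
have G'M w : M (w *m row' k G).
  apply: mulmx_in => i; have -> : row i (row' k G) = row (lift k i) G.
    by apply/rowP => j; rewrite !mxE.
  exact: spans_row.
split=> [/GM[w ->]|[w ->]//].
(* As [G] is graded, this component of [v] is again a syzygy; its [k]-th entry has degree 0, hence
   is the nonzero constant [c]. *)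
pose v' := mhpart (fun=> d' k) d' v.
have v'G : v' *m G = 0 by rewrite -(mhpartMr _ _ hG) vG mhpart0.
pose c := (v 0 k)@_0%MM.
have v'k : v' 0 k = c%:MP.
  apply/mpolyP => m; rewrite mxE mcoeff_hpart mcoeffC.
  rewrite -{2}[d' k]add0n eqn_add2r mdeg_eq0.
  by case: eqP => [->|_]; rewrite ?mulr1 ?mulr0.
(* Subtracting this multiple of a syzygy clears coordinate [k] without changing the product with
   [G]. *)
pose w' := w - ((c^-1)%:MP * w 0 k) *: v'.
have w'k : w' 0 k = 0.
  rewrite mxE (mxE _ _ 0 k) (mxE _ _ 0 k) v'k mulrAC -rmorphM mulVf //.
  by rewrite mul1r subrr.
exists (\row_i w' 0 (lift k i)).
have -> : w *m G = w' *m G by rewrite mulmxBl -scalemxAl v'G scaler0 subr0.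
apply/rowP => j; rewrite !mxE (bigD1_ord k) //= w'k mul0r add0r.
by apply: eq_bigr => i _; rewrite !mxE.
Qed.

End GradedSubmodule.

End Homogeneous.

(** * Existence of minimal graded free resolutions *)

Section Existence.

Variables (K : fieldType) (n : nat).

Lemma hentP a b (p : {mpoly K[n]}) :
  hent a b p <-> p = 0 \/ exists2 d, (b + d)%N = a & homog_of d p.
Proof.
split=> [hp|[->|[d <- hd]] m]; last first.
- by move=> /hd->; rewrite addnC.
- by rewrite mcoeff0 eqxx.
have [->|p0] := eqVneq p 0; [by left | right].
exists (mdeg (mlead p)); first by rewrite addnC hp ?mleadc_eq0.
by move=> m /hp E; apply: (@addIn b); rewrite E hp ?mleadc_eq0.
Qed.

(* One differential of the resolution under construction. The next one is built so
   that its target is definitionally the source of the previous one, which makes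
   the iterates composable without casts. *)
Record stage := Stage {
  src : nat;
  src_deg : 'I_src -> nat;
  tgt : nat;
  tgt_deg : 'I_tgt -> nat;
  mat : 'M[{mpoly K[n]}]_(src, tgt);
  mat_hom : mhent src_deg tgt_deg mat;
  mat_min : forall v : 'rV_src, v *m mat = 0 -> forall k, (v 0 k)@_0%MM = 0
}.

Record syzygy (s : stage) := Syzygy {
  syz_rk : nat;
  syz_deg : 'I_syz_rk -> nat;
  syz_mat : 'M[{mpoly K[n]}]_(syz_rk, src s);
  syz_hom : mhent syz_deg (@src_deg s) syz_mat;
  syz_min : forall v : 'rV_syz_rk, v *m syz_mat = 0 -> forall k, (v 0 k)@_0%MM = 0;
  syz_exact : forall v : 'rV_(src s), v *m mat s = 0 <-> exists w, v = w *m syz_mat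
}.

Lemma syzygy_exists (s : stage) : inhabited (syzygy s).
Proof.
have [||||t [d [D [hD DP Dmin]]]] := @minimal_homogeneous_generators K n _
  (@src_deg s) (fun v => v *m mat s = 0).
- by rewrite mul0mx.
- by move=> u v uM vM; rewrite mulmxDl uM vM addr0.
- by move=> c u uM; rewrite -scalemxAl uM scaler0.
- by move=> e v vM; rewrite -(mhpartMr _ _ (@mat_hom s)) vM mhpart0.
exact: inhabits (Syzygy hD Dmin DP).
Qed.

Definition some_syzygy (s : stage) : syzygy s :=
  epsilon (syzygy_exists s) (fun=> True).

Definition next_stage (s : stage) : stage :=
  Stage (@syz_hom _ (some_syzygy s)) (@syz_min _ (some_syzygy s)).

Lemma min_gfres_exists (I : {mpoly K[n]} -> Prop) :
  I 0 -> (forall p q, I p -> I q -> I (p + q)) -> (forall c p, I p -> I (c * p)) ->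
  (forall e p, I p -> I (hpart e 0 p)) -> (forall p, I p -> p@_0%MM = 0) ->
  exists F, is_min_gfres I F.
Proof.
move=> I0 ID IM Ih Ic.
have [||||t [d [D [hD DP Dmin]]]] := @minimal_homogeneous_generators K n 1
  (fun=> 0%N) (fun v => forall k, I (v 0 k)).
- by move=> k; rewrite mxE.
- by move=> u v Iu Iv k; rewrite mxE; apply: ID.
- by move=> c u Iu k; rewrite mxE; apply: IM.
- by move=> e v Iv k; rewrite mxE; apply: Ih.
pose st i := iter i next_stage (Stage hD Dmin).
exists (@GFRes K n (fun i => tgt (st i)) (fun i => @tgt_deg (st i))
  (fun i => mat (st i))).
split=> [|[|i] k l /=]; last first.
(* Rows of a later differential are syzygies of the previous one, whose minimality kills their
   constant terms. *)
- pose D' := syz_mat (some_syzygy (st i)).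
  have D'0 : row k D' *m mat (st i) = 0.
    by apply/syz_exact; exists (delta_mx 0 k); rewrite -rowE.
  by have := mat_min D'0 l; rewrite mxE.
(* Rows of the first differential lie in [I], hence in the maximal ideal. *)
- have /DP/(_ l) : exists w, row k D = w *m D by exists (delta_mx 0 k); rewrite rowE.
  by move=> /Ic; rewrite mxE.
split=> //= [i k l|i v].
  by apply/hentP; apply: mat_hom.
exact: syz_exact.
Qed.

End Existence.

Lemma row_factor (R : comNzRingType) p q r (A : 'M[R]_(p, r)) (D : 'M_(q, r)) :
  (forall k, exists w, row k A = w *m D) -> exists W, A = W *m D.
Proof.
move=> /fin_all_exists[w wP]; exists (\matrix_k w k).
by apply/row_matrixP => k; rewrite wP row_mul rowK.
Qed.

(** Rows of [A] in degree [j] are supported on columns of degree [j]. Restricting [A *m B = 1%:M] to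
    them gives a right invertible block, which has at least as many columns as rows. *)
Lemma diag_block_card (K : fieldType) a b (A : 'M[K]_(a, b)) (B : 'M_(b, a))
    (d : 'I_a -> nat) (e : 'I_b -> nat) (j : nat) :
  A *m B = 1%:M -> (forall k l, A k l != 0 -> d k = e l) ->
  (#|[set k | d k == j]| <= #|[set l | e l == j]|)%N.
Proof.
set X := [set k | d k == j]; set Y := [set l | e l == j] => AB hA.
pose A' := mxsub (@enum_val _ (mem X)) (@enum_val _ (mem Y)) A.
pose B' := mxsub (@enum_val _ (mem Y)) (@enum_val _ (mem X)) B.
apply: (@mulmx1_min _ _ _ A' B'); apply/matrixP => k l.
have /matrixP/(_ (enum_val k) (enum_val l)) := AB.
rewrite !mxE (inj_eq enum_val_inj) => <-.
rewrite [RHS](bigID (mem Y)) /= [X in _ + X]big1 ?addr0 => [|i iY]; last first.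
  have [->|/hA E] := eqVneq (A (enum_val k) i) 0; first by rewrite mul0r.
  case/negP: iY; rewrite inE -E.
  by have := enum_valP k; rewrite inE.
by rewrite [RHS]big_enum_val; apply: eq_bigr => i _; rewrite !mxE.
Qed.

(** * Betti numbers of retracts *)

Section Retract.

Variables (K : fieldType) (N N' : nat).
Local Notation T := {mpoly K[N]}.
Local Notation S := {mpoly K[N']}.
Variables (J : T -> Prop) (I : S -> Prop).
Variables (iota : {rmorphism T -> S}) (pi : {rmorphism S -> T}).
Hypothesis piK : cancel iota pi.
Hypothesis iota_hent : forall a b p, hent a b p -> hent a b (iota p).
Hypothesis pi_hent : forall a b p, hent a b p -> hent a b (pi p).
Hypothesis pi_const : forall p, (pi p)@_0%MM = p@_0%MM.
Hypotheses (J0 : J 0) (JD : forall p q, J p -> J q -> J (p + q)).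
Hypotheses (I0 : I 0) (ID : forall p q, I p -> I q -> I (p + q)).
Hypotheses (iotaJ : forall p, J p -> I (iota p)).
Hypotheses (piI : forall p, I p -> J (pi p)).
Variables (F : gfres K N) (G : gfres K N').
Hypotheses (resF : is_min_gfres J F) (resG : is_min_gfres I G).

Local Notation cst := (map_mx (mcoeff 0%MM)).

Lemma gfres_dif_hent N0 (I' : {mpoly K[N0]} -> Prop) H : is_gfres I' H ->
  forall i, mhent (@deg _ _ H i.+1) (@deg _ _ H i) (dif H i).
Proof. by case=> _ _ hom _ _ i k l; apply/hentP; apply: hom. Qed.

Lemma gfres_lift N0 (I' : {mpoly K[N0]} -> Prop) H : is_gfres I' H ->
  forall i p (A : 'M_(p, _)), A *m dif H i = 0 -> exists W, A = W *m dif H i.+1.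
Proof.
case=> _ _ _ ex _ i p A A0; apply: row_factor => k.
by apply/ex; rewrite -row_mul A0 row0.
Qed.

Lemma gfres_dif0 N0 (I' : {mpoly K[N0]} -> Prop) H : is_gfres I' H ->
  forall i, dif H i.+1 *m dif H i = 0.
Proof.
case=> _ _ _ ex _ i; apply/row_matrixP => k; rewrite row_mul row0.
by apply/ex; exists (delta_mx 0 k); rewrite rowE.
Qed.

(* The homotopy enters through the identity D_i theta_i = D_i h_i D_i, where
   theta = pi(phi) psi - 1; this is all the induction needs to produce h_(i+1) with
   theta_(i+1) = D_i h_i + h_(i+1) D_(i+1), whose constant part vanishes. *)
Lemma comparison_maps i : exists (phi : 'M[S]_(rk F i, rk G i))
    (psi : 'M[T]_(rk G i, rk F i)) w w' h,
  [/\ mhent (@deg _ _ F i) (@deg _ _ G i) phi,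
      mhent (@deg _ _ G i) (@deg _ _ F i) psi,
      map_mx iota (dif F i) *m phi = w *m dif G i,
      map_mx pi (dif G i) *m psi = w' *m dif F i &
      cst (map_mx pi phi *m psi) = 1%:M /\
      dif F i *m (map_mx pi phi *m psi - 1%:M) = dif F i *m h *m dif F i].
Proof.
have [gF mF] := resF; have [gG mG] := resG.
elim: i => [|i [phi [psi [w [w' [h [hphi hpsi wE w'E [_ hE]]]]]]]].
  have [rF dF _ _ exF] := gF; have [rG dG _ _ exG] := gG.
  (* Both ranks equal 1, but only propositionally, so the all-ones matrix stands for the
     identity. *)
  pose phi : 'M[S]_(rk F 0, rk G 0) := const_mx 1.
  pose psi : 'M[T]_(rk G 0, rk F 0) := const_mx 1.
  have [w wE] : exists w, map_mx iota (dif F 0) *m phi = w *m dif G 0.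
    apply: row_factor => k; apply/exG => l; rewrite !mxE.
    elim/big_ind: _ => // x _; rewrite !mxE mulr1; apply: iotaJ.
    have /exF/(_ x) : exists w, row k (dif F 0) = w *m dif F 0.
      by exists (delta_mx 0 k); rewrite rowE.
    by rewrite mxE.
  have [w' w'E] : exists w', map_mx pi (dif G 0) *m psi = w' *m dif F 0.
    apply: row_factor => k; apply/exF => l; rewrite !mxE.
    elim/big_ind: _ => // x _; rewrite !mxE mulr1; apply: piI.
    have /exG/(_ x) : exists w, row k (dif G 0) = w *m dif G 0.
      by exists (delta_mx 0 k); rewrite rowE.
    by rewrite mxE.
  have E : map_mx pi phi *m psi = 1%:M.
    apply/matrixP => k l; rewrite !mxE.
    have F0 (x : 'I_(rk F 0)) : x = 0%N :> nat.
      by case: x => [[|x] lx] //=; move: lx; rewrite rF.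
    have -> : k = l by apply: val_inj; rewrite /= !F0.
    rewrite eqxx; under eq_bigr => x _ do rewrite !mxE rmorph1 mulr1.
    by rewrite sumr_const card_ord rG.
  exists phi, psi, w, w', 0; split=> //.
  - move=> k l; rewrite mxE dF dG => m; rewrite mcoeff1.
    by case: (m =P 0%MM) => [->|_ /eqP[]]; rewrite ?mdeg0.
  - move=> k l; rewrite mxE dF dG => m; rewrite mcoeff1.
    by case: (m =P 0%MM) => [->|_ /eqP[]]; rewrite ?mdeg0.
  - by rewrite E map_mx1 subrr !mulmx0 mul0mx.
(* The lifts [w] and [w'] need not be graded; their degree-preserving components are, and they still
   make the squares commute. *)
pose phi' := mhpart (@deg _ _ F i.+1) (@deg _ _ G i.+1) w.
pose psi' := mhpart (@deg _ _ G i.+1) (@deg _ _ F i.+1) w'.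
have phiE : phi' *m dif G i = map_mx iota (dif F i) *m phi.
  rewrite -(mhpartMr _ _ (gfres_dif_hent gG (i := i))) -wE.
  rewrite (mhpartMl (b := @deg _ _ F i)) ?mhpart_id // => k l.
  by rewrite mxE; apply: iota_hent; exact: (gfres_dif_hent gF).
have psiE : psi' *m dif F i = map_mx pi (dif G i) *m psi.
  rewrite -(mhpartMr _ _ (gfres_dif_hent gF (i := i))) -w'E.
  rewrite (mhpartMl (b := @deg _ _ G i)) ?mhpart_id // => k l.
  by rewrite mxE; apply: pi_hent; exact: (gfres_dif_hent gG).
have [|v vE] := gfres_lift gG (i := i) (A := map_mx iota (dif F i.+1) *m phi').
  by rewrite -mulmxA phiE mulmxA -map_mxM (gfres_dif0 gF) map_mx0 mul0mx.
have [|v' v'E] := gfres_lift gF (i := i) (A := map_mx pi (dif G i.+1) *m psi').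
  by rewrite -mulmxA psiE mulmxA -map_mxM (gfres_dif0 gG) map_mx0 mul0mx.
pose theta := map_mx pi phi' *m psi' - 1%:M.
(* The commuting squares carry the error term across the differential, [piK] cancelling [iota]. *)
have thetaE : theta *m dif F i = dif F i *m h *m dif F i.
  rewrite -hE mulmxBl mulmxBr mul1mx mulmx1 -mulmxA psiE !mulmxA -map_mxM phiE.
  by rewrite map_mxM -map_mx_comp (eq_map_mx _ piK) map_mx_id.
(* By [thetaE], [theta - dif F i *m h] is killed by [dif F i], so exactness provides the next
   homotopy. *)
have [|h' h'E] := gfres_lift gF (i := i) (A := theta - dif F i *m h).
  by rewrite mulmxBl thetaE subrr.
have cF k : cst (dif F k) = 0 by apply/matrixP => x y; rewrite !mxE mF.
have thetaD : theta = dif F i *m h + h' *m dif F i.+1 by rewrite -h'E addrC subrK.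
exists phi', psi', v, v', h'; split=> //; try exact: mhent_mhpart.
split; last first.
  by rewrite -/theta thetaD mulmxDr mulmxA (gfres_dif0 gF) mul0mx add0r mulmxA.
(* Both summands of [theta] contain a differential of the minimal resolution [F], so its constant
   part is 0. *)
have -> : map_mx pi phi' *m psi' = theta + 1%:M by rewrite subrK.
by rewrite map_mxD map_mx1 thetaD map_mxD !map_mxM !cF mul0mx mulmx0 !add0r.
Qed.

(** The constant parts of [phi] and [psi] compose to the identity, and a nonzero constant in a
    graded entry forces equal generator degrees. *)
Lemma retract_betti_le i j :
  (#|[set k | @deg _ _ F i k == j]| <= #|[set k | @deg _ _ G i k == j]|)%N.
Proof.
have [phi [psi [_ [_ [_ [hphi _ _ _ [E _]]]]]]] := comparison_maps i.
apply: (@diag_block_card K _ _ (cst phi) (cst psi)) => [|k l].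
  rewrite -E map_mxM; congr (_ *m _).
  by apply/matrixP => k l; rewrite !mxE; apply/esym/pi_const.
by rewrite mxE => /hphi; rewrite mdeg0 add0n.
Qed.

End Retract.

(** * Edge ideals of induced subgraphs *)

Section LinearSubstitution.

Variables (K : fieldType) (n n' : nat) (t : n.-tuple {mpoly K[n']}).
Hypothesis t_lin : forall i, tnth t i \is 1.-homog.

Lemma monomial_subst_homog (m : 'X_{1..n}) :
  \prod_(i < n) tnth t i ^+ m i \is (mdeg m).-homog.
Proof.
rewrite mdegE; elim/big_ind2: _ => [|d p e q|i _]; first exact: dhomog1.
  exact: dhomogM.
by have := dhomogMn (m i) (t_lin i); rewrite mul1n.
Qed.

Lemma hent_subst a b p : hent a b p -> hent a b (p \mPo t).
Proof.
move=> hp m; rewrite comp_mpolyEX raddf_sum /=; apply: contraNeq => mN.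
apply/eqP; rewrite big_seq big1 // => k kp; rewrite mcoeffZ comp_mpolyX.
rewrite (dhomog_nemf_coeff (monomial_subst_homog k)) ?mulr0 //.
apply: contraNneq mN => ->; apply/eqP/hp.
by rewrite -mcoeff_msupp.
Qed.

(** A nonconstant monomial becomes a form of positive degree, which has no constant term. *)
Lemma const_subst p : (p \mPo t)@_0%MM = p@_0%MM.
Proof.
have t0 i : (tnth t i)@_0%MM = 0.
  by apply: (dhomog_nemf_coeff (t_lin i)); rewrite /= mdeg0.
rewrite comp_mpolyEX [in RHS](mpolyE p) !raddf_sum /=; apply: eq_bigr => m _.
rewrite !mcoeffZ comp_mpolyX mcoeffX; congr (_ * _).
have [->|m0] := eqVneq m 0%MM.
  by rewrite big1 ?mcoeff1 ?eqxx // => i _; rewrite mnm0E expr0.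
by apply: (dhomog_nemf_coeff (monomial_subst_homog m)); rewrite /= mdeg0 eq_sym mdeg_eq0.
Qed.

End LinearSubstitution.

(** * Homogeneity of the edge ideal *)

Section EdgeIdeal.

Variables (K : fieldType) (n : nat) (E : rel 'I_n).
Local Notation I := (@I_G K n E).

Lemma I_G0 : I 0.
Proof. by exists (fun=> 0); rewrite big1 // => e _; rewrite mul0r. Qed.

Lemma I_GD p q : I p -> I q -> I (p + q).
Proof.
move=> [c ->] [d ->]; exists (fun e => c e + d e); rewrite -big_split /=.
by apply: eq_bigr => e _; rewrite mulrDl.
Qed.

Lemma I_GM c p : I p -> I (c * p).
Proof.
move=> [d ->]; exists (fun e => c * d e); rewrite mulr_sumr.
by apply: eq_bigr => e _; rewrite mulrA.
Qed.

Lemma I_G_gen e : I (binom_edge_gen K E e).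
Proof.
exists (fun e' => (e' == e)%:R); rewrite (bigD1 e) //= eqxx mul1r.
by rewrite big1 ?addr0 // => e' /negPf->; rewrite mul0r.
Qed.

Lemma binom_edge_gen_hent e : hent 2 0 (binom_edge_gen K E e).
Proof.
move=> m; rewrite addn0 /binom_edge_gen; case: ifP => _; last first.
  by rewrite mcoeff0 eqxx.
rewrite /xvar /yvar -!mpolyXD mcoeffB !mcoeffX.
case: (_ =P m) => [<- _|_]; first by rewrite mdegD !mdeg1.
case: (_ =P m) => [<- _|_]; first by rewrite mdegD !mdeg1.
by rewrite subrr eqxx.
Qed.

(** The generators are homogeneous of degree 2, so it suffices to cut down the coefficients. *)
Lemma I_G_hpart a p : I p -> I (hpart a 0 p).
Proof.
move=> [c ->]; exists (fun e => hpart a 2 (c e)); rewrite hpart_sum.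
by apply: eq_bigr => e _; apply/hpartMr/binom_edge_gen_hent.
Qed.

Lemma I_G_const p : I p -> p@_0%MM = 0.
Proof.
move=> [c ->]; rewrite raddf_sum big1 // => e _ /=; rewrite rmorphM /=.
have [->|/binom_edge_gen_hent] := eqVneq (binom_edge_gen K E e)@_0%MM 0.
  by rewrite mulr0.
by rewrite mdeg0.
Qed.

End EdgeIdeal.

(** * The algebra retract given by an induced subgraph *)

Section InducedSubgraph.

Variables (K : fieldType) (m n : nat) (EH : rel 'I_m) (EG : rel 'I_n).
Variable f : 'I_m -> 'I_n.
Hypothesis Hf : induced_subgraph EH EG f.

Definition incl_tuple : (m + m).-tuple {mpoly K[n + n]} :=
  [tuple match split k with inl i => xvar K (f i) | inr i => yvar K (f i) end
    | k < m + m].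

Definition retr_tuple : (n + n).-tuple {mpoly K[m + m]} :=
  [tuple match split k with
         | inl j => if [pick i | f i == j] is Some i then xvar K i else 0
         | inr j => if [pick i | f i == j] is Some i then yvar K i else 0
         end | k < n + n].

Local Notation incl := (comp_mpoly incl_tuple).
Local Notation retr := (comp_mpoly retr_tuple).

Lemma incl_lin k : tnth incl_tuple k \is 1.-homog.
Proof. by rewrite tnth_mktuple; case: split => i; rewrite dhomogX /= mdeg1. Qed.

(** Killed variables are covered because 0 is homogeneous of every degree. *)
Lemma retr_lin k : tnth retr_tuple k \is 1.-homog.
Proof.
rewrite tnth_mktuple; case: split => i; case: pickP => [j _|_];
  by rewrite ?dhomog0 // dhomogX /= mdeg1.
Qed.

Lemma incl_x i : incl (xvar K i) = xvar K (f i).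
Proof.
by rewrite comp_mpolyXU -tnth_nth tnth_mktuple (unsplitK (inl i)).
Qed.

Lemma incl_y i : incl (yvar K i) = yvar K (f i).
Proof.
by rewrite comp_mpolyXU -tnth_nth tnth_mktuple (unsplitK (inr i)).
Qed.

Lemma retr_x j : retr (xvar K j) =
  if [pick i | f i == j] is Some i then xvar K i else 0.
Proof.
by rewrite comp_mpolyXU -tnth_nth tnth_mktuple (unsplitK (inl j)).
Qed.

Lemma retr_y j : retr (yvar K j) =
  if [pick i | f i == j] is Some i then yvar K i else 0.
Proof.
by rewrite comp_mpolyXU -tnth_nth tnth_mktuple (unsplitK (inr j)).
Qed.

Lemma pick_f i : [pick i' | f i' == f i] = Some i.
Proof.
case: pickP => [i' /eqP/Hf.1->//|/(_ i)]; by rewrite eqxx.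
Qed.

Lemma retr_inclK : cancel incl retr.
Proof.
move=> p; rewrite (comp_mpolyEX p) raddf_sum [RHS]mpolyE; apply: eq_bigr => a _ /=.
rewrite comp_mpolyZ; congr (_ *: _); rewrite [in RHS]mpolyXE_id.
rewrite comp_mpolyX rmorph_prod /=; apply: eq_bigr => k _; rewrite rmorphXn /=.
congr (_ ^+ _); rewrite tnth_mktuple; case: split_ordP => i ->.
  by rewrite retr_x pick_f.
by rewrite retr_y pick_f.
Qed.

Lemma incl_I_G p : I_G EH p -> I_G EG (incl p).
Proof.
move=> [c ->]; rewrite raddf_sum; elim/big_ind: _ => [||e _] /=.
- exact: I_G0.
- exact: I_GD.
rewrite rmorphM /=; apply: I_GM.
have -> : incl (binom_edge_gen K EH e) = binom_edge_gen K EG (f e.1, f e.2).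
  rewrite /binom_edge_gen /= -Hf.2; case: ifP => _; last exact: rmorph0.
  by rewrite rmorphB !rmorphM /= !incl_x !incl_y.
exact: I_G_gen.
Qed.

(** If an edge leaves the image of [f], both products of its generator contain a killed variable.
    Otherwise it comes from an edge of [EH], the subgraph being induced. *)
Lemma retr_I_G p : I_G EG p -> I_G EH (retr p).
Proof.
move=> [c ->]; rewrite raddf_sum; elim/big_ind: _ => [||[j k] _] /=.
- exact: I_G0.
- exact: I_GD.
rewrite rmorphM /=; apply: I_GM.
rewrite /binom_edge_gen /=; case: ifP => Ejk; last by rewrite rmorph0; exact: I_G0.
rewrite rmorphB !rmorphM /= !retr_x !retr_y.
case: pickP => [i /eqP fi|_]; last by rewrite !mul0r subrr; exact: I_G0.
case: pickP => [l /eqP fl|_]; last by rewrite !mulr0 subrr; exact: I_G0.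
suff -> : xvar K i * xvar K l - yvar K i * yvar K l = binom_edge_gen K EH (i, l).
  exact: I_G_gen.
by rewrite /binom_edge_gen /= Hf.2 fi fl Ejk.
Qed.

End InducedSubgraph.

Theorem theorem3p7 (K : fieldType) (n m : nat) (EG : rel 'I_n) (EH : rel 'I_m)
  (f : 'I_m -> 'I_n) :
  simple_graph EG -> induced_subgraph EH EG f ->
  forall i j : nat, (betti (@I_G K m EH) i j <= betti (@I_G K n EG) i j)%N.
Proof.
move=> _ Hf i j; rewrite /betti.
case: excluded_middle_informative => [hH|//].
(* On this side the default value 0 could break the inequality, so a resolution must exist. *)
case: excluded_middle_informative => [hG|[]]; last first.
  apply: min_gfres_exists; [exact: I_G0 | exact: I_GD | exact: I_GM
                           | exact: I_G_hpart | exact: I_G_const].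
case: (constructive_indefinite_description _ hH) => F resF /=.
case: (constructive_indefinite_description _ hG) => G resG /=.
apply: (@retract_betti_le K _ _ (I_G EH) (I_G EG)
  (comp_mpoly (incl_tuple K f)) (comp_mpoly (retr_tuple K f))) => //.
- exact: retr_inclK Hf.
- by move=> a b p; apply/hent_subst/incl_lin.
- by move=> a b p; apply/hent_subst/retr_lin.
- by move=> p; apply/const_subst/retr_lin.
- exact: I_G0.
- exact: I_GD.
- exact: I_G0.
- exact: I_GD.
- exact: incl_I_G.
- exact: retr_I_G.
Qed.
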